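(* Consider a multi-agent multi-layer barrier coverage system with $K^*$ layers, and let agent $i$ be working on layer $k$. Let $v\neq k$ be another layer. If $$P_k'<\frac{(1-P_k)\,P_v'}{1-P_v-P_v'},$$ then the detection probability $P=1-\prod_{j=1}^{K^*}(1-P_j)$ of the system increases if agent $i$ leaves layer $k$ and enters layer $v$. Here $P_k,P_v$ are the detection probabilities of layers $k,v$ before the move, and $P_k'$, $P_v'$ are the departure and entry quantities defined in the context.
   Context: There are $K^*$ layers, closed curves in polar coordinates about the origin with radii $0<R_1(\theta)<\dots<R_{K^*}(\theta)$; points of a layer are identified with phases $\theta\in[0,2\pi)$ (modulo $2\pi$), and $\int_a^b$ denotes integration over the arc from $a$ to $b$ in the direction of increasing phase. Each layer $j$ has $N_j$ working agents with distinct phases $\varphi_l$. For an agent $i$ working on a layer, $\alpha,\beta$ denote the working agents of that layer immediately preceding and following $i$ in the direction of increasing phase. Each working agent $l$ has a division point $s_l$ on the arc from its preceding neighbour to itself; its sub-area $E_l$ is the arc from $s_l$ to the division point of its following neighbour (a single agent $i$ on a layer has $s_i=\varphi_i+\pi$ mod $2\pi$ and the whole layer as sub-area). Each division point is kept at the midpoint of the arc between the two consecutive agents it separates (at equal $d$-distance from both). $E_i^2$ is the arc from $s_i$ to $\varphi_i$, $E_i^3$ the arc from $\varphi_i$ to $s_\beta$. Angular distance: $\delta(\varphi,\theta)=|\varphi-\theta-2\pi|$ if $\varphi-\theta>\pi$; $|\varphi-\theta+2\pi|$ if $\varphi-\theta\le-\pi$; $|\varphi-\theta|$ otherwise. The distance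 function $d(\varphi,\theta)$ is Lipschitz continuous and proportional to $\delta(\varphi,\theta)$ (with positive constant). $f(d(\varphi,\theta))$ is the probability that an agent at $\varphi$ detects an intruder at $\theta$; $f$ is differentiable and monotonically decreasing. $\rho(\theta)\ge0$ is the probability density of the intrusion location. The detection probability of layer $j$ is $P_j=\sum_l\int_{E_l}f(d(\varphi_l,\theta))\rho(\theta)\,d\theta$, over agents $l$ working on layer $j$ ($0$ if there are none). Departure quantity (for layer $k$ with $N_k\ge2$, computed with $s_i,s_\beta$ on layer $k$ before the departure): $$P_k'=\int_{E_i^2}\big(f(d(\varphi_i,\theta))-f(d(s_i,\varphi_i)+d(s_i,\theta))\big)\rho(\theta)\,d\theta+\int_{E_i^3}\big(f(d(\varphi_i,\theta))-f(d(s_\beta,\varphi_i)+d(s_\beta,\theta))\big)\rho(\theta)\,d\theta .$$ Entry quantity (for layer $v$, with $\varphi_i,\alpha,\beta,s_i,s_\beta,E_i^2,E_i^3$ those of agent $i$ on layer $v$ after the entry): $$P_v'=\int_{E_i^2\cup E_i^3}f(d(\varphi_i,\theta))\rho(\theta)\,d\theta-\int_{s_\beta^*}^{s_\beta}f(d(\varphi_\beta,\theta))\rho(\theta)\,d\theta-\int_{s_i}^{s_\beta^*}f(d(\varphi_\alpha,\theta))\rho(\theta)\,d\theta ,$$ where $s_\beta^*$ is the division point between $\alpha$ and $\beta$ on layer $v$ before the entry; the two subtracted terms are zero if layer $v$ was empty. The comparison is between the system before the move and just after it: all other agents remain on their layers with unchanged phases, and the division points affected by the departure and the entry are reset to the midpoints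 between the new consecutive agents. ''Increases'' means the value of $P$ after the move is strictly larger than before. *)

(* Defs.v *)
From HB Require Import structures.
From mathcomp Require Import all_boot all_order all_algebra.
From mathcomp Require Import all_classical all_reals all_analysis.
Set Implicit Arguments.
Unset Strict Implicit.
Unset Printing Implicit Defensive.
Import Order.TTheory GRing.Theory Num.Theory.
Import numFieldTopology.Exports numFieldNormedType.Exports.
Local Open Scope classical_set_scope.
Local Open Scope ring_scope.

Section Phases.
Context {R : realType}.
Implicit Types x y a b phi theta : R.

Definition phases : set R := `[0, 2 * pi[.

(* The representative of x modulo 2 pi that lies in [0, 2 pi). *)
Definition mod2pi x : R := x - 2 * pi * (Num.floor (x / (2 * pi)))%:~R.

(* Length of the arc from a to b in the direction of increasing phase. The arc
   from a phase to itself is the whole circle, not the empty arc: it occurs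
   only for a single agent, which is its own predecessor and successor and
   whose sub-area is the whole layer. *)
Definition gap a b : R := if mod2pi (b - a) == 0 then 2 * pi else mod2pi (b - a).

(* Half-open (closed at a, open at b), so that adjacent arcs are disjoint. *)
Definition phase_arc a b : set R :=
  [set theta | phases theta /\ mod2pi (theta - a) < gap a b].

Definition midpoint a b : R := mod2pi (a + gap a b / 2).

Definition delta phi theta : R :=
  if phi - theta > pi then `|phi - theta - 2 * pi|
  else if phi - theta <= - pi then `|phi - theta + 2 * pi|
  else `|phi - theta|.

End Phases.

Section Model.
Context {R : realType}.

(* Closed curves: the radius is continuous and 2 pi-periodic in the phase. *)
Definition layer_curves (K : nat) (r : 'I_K -> R -> R) : Prop :=
  [/\ forall j, continuous (r j),
      forall j theta, r j (theta + 2 * pi) = r j theta,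
      forall j theta, 0 < r j theta
    & forall (j j' : 'I_K) theta, (j < j')%N -> r j theta < r j' theta].

Definition distance_function (d : R -> R -> R) : Prop :=
  [lipschitz d x.1 x.2 | x in phases `*` phases] /\
  exists2 c : R, 0 < c &
    forall phi theta, phases phi -> phases theta -> d phi theta = c * delta phi theta.

(* f is a function of a distance, hence is only constrained on [0, +oo[, with a
   one-sided derivative at 0. *)
Definition detection_function (d : R -> R -> R) (f : R -> R) : Prop :=
  [/\ forall x : R, 0 <= x ->
        cvg ((fun h : R => h^-1 * (f (x + h) - f x))
               @ within [set h | 0 <= x + h] 0^'),
      forall x y : R, 0 <= x -> x < y -> f y < f x
    & forall phi theta, phases phi -> phases theta -> 0 <= f (d phi theta) <= 1].

Definition intrusion_density (rho : R -> R) : Prop :=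
  [/\ measurable_fun phases rho,
      forall theta, phases theta -> 0 <= rho theta
    & (\int[@lebesgue_measure R]_(theta in phases) (rho theta)%:E = 1)%E].

End Model.

(* [layer l = None] means that the agent l is not working; its phase is then
   irrelevant. *)
Record configuration (R : realType) (K : nat) (A : finType) := Configuration {
  layer : A -> option 'I_K;
  phase : A -> R
}.

Section Coverage.
Context {R : realType} {K : nat} {A : finType}.
Implicit Types (c : configuration R K A) (j k v : 'I_K) (i l m : A).

Definition workers c j : {set A} := [set l | layer c l == Some j].

Definition valid c : Prop :=
  (forall l j, l \in workers c j -> phases (phase c l)) /\
  (forall l m j, l \in workers c j -> m \in workers c j ->
     phase c l = phase c m -> l = m).

(* Neighbours on the layer of l; both are l itself if l is alone there. *)
Definition pred_agent c l : A :=
  [arg min_(m < l | layer c m == layer c l) gap (phase c m) (phase c l)]%O.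

Definition succ_agent c l : A :=
  [arg min_(m < l | layer c m == layer c l) gap (phase c l) (phase c m)]%O.

Definition division c l : R := midpoint (phase c (pred_agent c l)) (phase c l).

Definition division_next c l : R := division c (succ_agent c l).

Definition subarea c l : set R := phase_arc (division c l) (division_next c l).
Definition subarea2 c l : set R := phase_arc (division c l) (phase c l).
Definition subarea3 c l : set R := phase_arc (phase c l) (division_next c l).

Variables (d : R -> R -> R) (f rho : R -> R).
Local Notation mu := (@lebesgue_measure R).

Definition layer_prob c j : R :=
  \sum_(l in workers c j)
    \int[mu]_(theta in subarea c l) (f (d (phase c l) theta) * rho theta).

Definition system_prob c : R := 1 - \prod_(j < K) (1 - layer_prob c j).

Definition departure_quantity c i : R :=
  let phi := phase c i in
  let s := division c i in
  let s' := division_next c i in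
  \int[mu]_(theta in subarea2 c i)
     ((f (d phi theta) - f (d s phi + d s theta)) * rho theta) +
  \int[mu]_(theta in subarea3 c i)
     ((f (d phi theta) - f (d s' phi + d s' theta)) * rho theta).

(* Agent i, wherever it was, now works on layer v at phase psi. *)
Definition move c i v (psi : R) : configuration R K A :=
  Configuration
    (fun l => if l == i then Some v else layer c l)
    (fun l => if l == i then psi else phase c l).

(* [c] and [c'] are the configurations before and after the entry of i into
   layer v. If v was not empty, the division point between alpha and beta
   before the entry is that of beta in [c]. *)
Definition entry_quantity c c' i v : R :=
  let alpha := pred_agent c' i in
  let beta := succ_agent c' i in
  let s := division c' i in
  let s' := division_next c' i in
  let s_old := division c beta in
  \int[mu]_(theta in subarea2 c' i `|` subarea3 c' i)
     (f (d (phase c' i) theta) * rho theta)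
  - (if workers c v == finset.set0 then 0 else
       \int[mu]_(theta in phase_arc s_old s') (f (d (phase c' beta) theta) * rho theta)
     + \int[mu]_(theta in phase_arc s s_old) (f (d (phase c' alpha) theta) * rho theta)).

End Coverage.

(* Main.v *)
Require Import Defs.
From HB Require Import structures.
From mathcomp Require Import all_boot all_order all_algebra.
From mathcomp Require Import all_classical all_reals all_analysis.
From mathcomp Require Import measurable_realfun lra.
Import Order.TTheory GRing.Theory Num.Theory.
Set Implicit Arguments.
Unset Strict Implicit.
Local Open Scope classical_set_scope.
Local Open Scope ring_scope.

(* Since division points are midpoints, the sub-areas of a layer are the Voronoi
   cells of its agents, so the layer probability is the integral of rho times f
   of the distance to the nearest agent. Comparing these integrands pointwise,
   P_k drops by at most P_k' (by the triangle inequality through s_i or s_beta,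
   a point of E_i is within d(s, phi_i) + d(s, theta) of a neighbour of i) and
   P_v grows by at least P_v'. Every layer probability is < 1, because f is
   strictly decreasing with values in [0, 1] and rho has no atoms; hence the
   denominator in the hypothesis is positive and the factors of the other layers
   may be cancelled. *)

(** * Phases *)

(** Only inequalities are needed: with all layer probabilities below 1, P increases with each of
    them, so lower bounds for the new values on layers [k] and [v] suffice. The threshold comes from
    expanding a product. The new survival factors of the two layers multiply to at most (1 - P_k +
    P_k')(1 - P_v - P_v'), and the hypothesis, multiplied by its denominator, says exactly that this
    is less than (1 - P_k)(1 - P_v). The obstacle to the Voronoi reading is ties: a division point
    is equally near to two agents, so nearness alone does not give disjoint cells. Arcs closed at
    their start assign such a point to the agent that follows it, and a strict comparison of forward
    gaps records this tie-break. A lone agent is its own neighbour at gap 2 pi, which lets most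
    statements about neighbours cover it without a separate hypothesis. *)

(** Used with n = 0, -1 and 1, which covers differences of phases and midpoints; [mod2pi] then
    becomes piecewise linear and within reach of [lra]. *)
Lemma mod2pi_shift {R : realType} (n : int) (x : R) :
  2 * pi * n%:~R <= x < 2 * pi * (n + 1)%:~R -> mod2pi x = x - 2 * pi * n%:~R.
Proof.
move=> /andP[nx xn]; have pi0 : 0 < 2 * pi :> R by rewrite mulr_gt0 // pi_gt0.
rewrite /mod2pi (@Num.Theory.floor_def _ _ n) //.
by rewrite ler_pdivlMr // ltr_pdivrMr // mulrC nx mulrC xn.
Qed.

Lemma mod2pi_id {R : realType} (x : R) : 0 <= x < 2 * pi -> mod2pi x = x.
Proof.
by move=> hx; rewrite (@mod2pi_shift _ 0) ?mulr0 ?subr0 // add0r mulr1.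
Qed.

Lemma mod2pi_lt0 {R : realType} (x : R) :
  - (2 * pi) <= x < 0 -> mod2pi x = x + 2 * pi.
Proof.
by move=> hx; rewrite (@mod2pi_shift _ (-1)) ?mulrN1 ?opprK // addNr mulr0.
Qed.

Lemma mod2pi_ge2pi {R : realType} (x : R) :
  2 * pi <= x < 4 * pi -> mod2pi x = x - 2 * pi.
Proof.
move=> hx; rewrite (@mod2pi_shift _ 1) ?mulr1 // intrD.
by move: hx; rewrite -[1%:~R]/(1 : R) => /andP[? ?]; apply/andP; split; lra.
Qed.

Lemma phasesE {R : realType} (x : R) : phases x = (0 <= x < 2 * pi) :> Prop.
Proof. by rewrite /phases /= in_itv. Qed.

Lemma mod2pi_phases {R : realType} (x : R) : phases (mod2pi x).
Proof.
have pi0 : 0 < 2 * pi :> R by rewrite mulr_gt0 // pi_gt0.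
have /andP[h1 h2] := floor_itv (x / (2 * pi)).
rewrite phasesE /mod2pi subr_ge0 ltrBlDl -[X in _ < _ + X]mulr1 -mulrDr.
by rewrite -intrD1 mulrC -ler_pdivlMr // h1 /= mulrC -ltr_pdivrMr.
Qed.

Lemma midpoint_phases {R : realType} (a b : R) : phases (midpoint a b).
Proof. exact: mod2pi_phases. Qed.

Lemma mod2piB {R : realType} (a x : R) : phases a -> phases x ->
  mod2pi (x - a) = if a <= x then x - a else x - a + 2 * pi.
Proof.
rewrite !phasesE => /andP[? ?] /andP[? ?]; case: leP => ?.
  by rewrite mod2pi_id //; apply/andP; split; lra.
by rewrite mod2pi_lt0 //; apply/andP; split; lra.
Qed.

Lemma gapE {R : realType} (a b : R) : phases a -> phases b ->
  gap a b = if a < b then b - a else b - a + 2 * pi.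
Proof.
move=> ha hb; rewrite /gap mod2piB //; move: ha hb; rewrite !phasesE.
move=> /andP[? ?] /andP[? ?].
case: (ltgtP a b) => [ab|ab|->]; rewrite ?subrr ?eqxx ?add0r // ifF //.
  by apply/negbTE; rewrite subr_eq0 gt_eqF.
by apply/negbTE/eqP; lra.
Qed.

Lemma midpointE {R : realType} (a b : R) : phases a -> phases b ->
  midpoint a b = if a + gap a b / 2 < 2 * pi then a + gap a b / 2
                 else a + gap a b / 2 - 2 * pi.
Proof.
move=> ha hb; rewrite /midpoint gapE //; move: ha hb; rewrite !phasesE.
move=> /andP[? ?] /andP[? ?]; case: (ltP a b) => ?; case: ltP => ?.
- by rewrite mod2pi_id //; apply/andP; split; lra.
- by rewrite mod2pi_ge2pi //; apply/andP; split; lra.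
- by rewrite mod2pi_id //; apply/andP; split; lra.
- by rewrite mod2pi_ge2pi //; apply/andP; split; lra.
Qed.

Lemma deltaE {R : realType} (x y : R) : phases x -> phases y ->
  delta x y = if x <= y then if y - x < pi then y - x else 2 * pi - (y - x)
              else if x - y <= pi then x - y else 2 * pi - (x - y).
Proof.
rewrite !phasesE => /andP[? ?] /andP[? ?]; rewrite /delta.
by do ![case: ltP => ? | case: leP => ?];
  first [rewrite ger0_norm; lra | rewrite ler0_norm; lra | lra].
Qed.

Lemma phase_arcE {R : realType} (a b x : R) : phases a -> phases x ->
  phase_arc a b x <-> (if a <= x then x - a else x - a + 2 * pi) < gap a b.
Proof. by move=> ha hx; rewrite -mod2piB //; split=> [[]|]. Qed.

Lemma gap_itv {R : realType} (a b : R) : phases a -> phases b ->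
  0 < gap a b <= 2 * pi.
Proof.
move=> ha hb; rewrite gapE //; move: ha hb; rewrite !phasesE.
by move=> /andP[? ?] /andP[? ?]; case: (ltP a b) => ?; apply/andP; split; lra.
Qed.

Lemma gapxx {R : realType} (a : R) : phases a -> gap a a = 2 * pi.
Proof. by move=> ha; rewrite gapE // ltxx subrr add0r. Qed.

Lemma gapC {R : realType} (a b : R) : phases a -> phases b -> a != b ->
  gap a b + gap b a = 2 * pi.
Proof.
by move=> ha hb; rewrite !gapE //; case: ltgtP => // ? _; lra.
Qed.

Lemma gap_injl {R : realType} (b x y : R) : phases b -> phases x -> phases y ->
  gap x b = gap y b -> x = y.
Proof.
move=> hb hx hy; rewrite !gapE //; move: hb hx hy; rewrite !phasesE.
by move=> /andP[? ?] /andP[? ?] /andP[? ?]; do ![case: ltP => ?]; lra.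
Qed.

Lemma gap_injr {R : realType} (b x y : R) : phases b -> phases x -> phases y ->
  gap b x = gap b y -> x = y.
Proof.
move=> hb hx hy; rewrite !gapE //; move: hb hx hy; rewrite !phasesE.
by move=> /andP[? ?] /andP[? ?] /andP[? ?]; do ![case: ltP => ?]; lra.
Qed.

(** Travelling from [x] to [z] through [y] costs one extra turn exactly when [y] is not met before
    [z]. Most later statements on cyclic order reduce to this rule. *)
Lemma gap_split {R : realType} (x y z : R) : phases x -> phases y -> phases z ->
  gap x y + gap y z = if gap x y < gap x z then gap x z else gap x z + 2 * pi.
Proof.
move=> hx hy hz; rewrite !gapE //; move: hx hy hz; rewrite !phasesE.
by move=> /andP[? ?] /andP[? ?] /andP[? ?];
  case: (ltP x y) => ?; case: (ltP y z) => ?; case: (ltP x z) => ?;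
  try case: ltP => ?; lra.
Qed.

Lemma delta_gap {R : realType} (x y : R) : phases x -> phases y -> x != y ->
  delta x y = Num.min (gap x y) (gap y x).
Proof.
move=> hx hy xy; rewrite deltaE // !gapE //; move: hx hy xy; rewrite !phasesE.
move=> /andP[? ?] /andP[? ?].
by case: (ltgtP x y) => // ? _; rewrite minEle;
  do ![case: leP => ? | case: ltP => ?]; lra.
Qed.

Lemma deltaxx {R : realType} (x : R) : phases x -> delta x x = 0.
Proof. by move=> hx; rewrite deltaE // lexx subrr pi_gt0. Qed.

Lemma delta_ge0 {R : realType} (x y : R) :
  phases x -> phases y -> 0 <= delta x y.
Proof. by move=> hx hy; rewrite /delta; do ![case: ifP => ?]. Qed.

Lemma deltaC {R : realType} (x y : R) :
  phases x -> phases y -> delta x y = delta y x.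
Proof.
move=> hx hy; have [->//|xy] := eqVneq x y.
by rewrite !delta_gap // 1?eq_sym // minC.
Qed.

Lemma delta_triangle {R : realType} (x y z : R) :
  phases x -> phases y -> phases z -> delta x z <= delta x y + delta y z.
Proof.
move=> hx hy hz; rewrite !deltaE //; move: hx hy hz; rewrite !phasesE.
move=> /andP[? ?] /andP[? ?] /andP[? ?].
by case: (leP x z) => ?; case: (leP x y) => ?; case: (leP y z) => ?;
   repeat first [case: (ltP _ pi) => ? | case: (leP _ pi) => ?]; lra.
Qed.

(** * Arcs, midpoints, and the nearest endpoint of an arc *)

(** The start [a] needs its own disjunct: it belongs to the arc, yet its gap from itself is a full
    turn. *)
Lemma phase_arc_gap {R : realType} (a b x : R) :
  phases a -> phases b -> phases x ->
  phase_arc a b x <-> x = a \/ gap a x < gap a b.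
Proof.
move=> ha hb hx; rewrite phase_arcE // (gapE ha hx) //.
have /andP[h0 h1] := gap_itv ha hb.
move: h0 h1; move: (gap a b) => g ? ?.
case: (ltgtP a x) => ax; last by split; [left|subst; rewrite subrr].
  by split; [right|case=> [?|//]; lra].
by split; [right|case=> [?|//]; lra].
Qed.

Lemma phase_arc_split {R : realType} (x y z t : R) :
  phases x -> phases y -> phases z -> phases t -> gap x y + gap y z = gap x z ->
  (phase_arc x z t <-> phase_arc x y t \/ phase_arc y z t) /\
  ~ (phase_arc x y t /\ phase_arc y z t).
Proof.
move=> hx hy hz ht; rewrite !phase_arcE // !gapE //; move: hx hy hz ht.
rewrite !phasesE => /andP[? ?] /andP[? ?] /andP[? ?] /andP[? ?].
case: (ltP x y) => ?; case: (ltP y z) => ?; case: (ltP x z) => ?;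
  case: (leP x t) => ?; case: (leP y t) => ? ?; (split; [split|]);
  first [lra | by case; lra | by case=> ?; lra | idtac].
all: by move=> ?; first [left; lra | right; lra | lra].
Qed.

Lemma gap_midpointr {R : realType} (a b : R) : phases a -> phases b ->
  gap a (midpoint a b) = gap a b / 2.
Proof.
move=> ha hb; have hm := midpoint_phases a b; have /andP[g0 g1] := gap_itv ha hb.
have pi0 := @pi_gt0 R.
rewrite (gapE ha hm) midpointE //; move: ha; rewrite phasesE => /andP[? ?].
move: g0 g1; move: (gap a b) => g ? ?.
case: (ltP (a + g / 2) (2 * pi)) => ?.
  by case: (ltP a (a + g / 2)) => ?; lra.
by case: (ltP a (a + g / 2 - 2 * pi)) => ?; lra.
Qed.

Lemma gap_midpointl {R : realType} (a b : R) : phases a -> phases b ->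
  gap (midpoint a b) b = gap a b / 2.
Proof.
move=> ha hb; have hm := midpoint_phases a b.
have := gap_split ha hm hb; rewrite gap_midpointr //.
have /andP[g0 g1] := gap_itv ha hb.
by rewrite ifT => [?|]; lra.
Qed.

(** Both inequalities say that [m] is not strictly inside the arc from [a] to [b]; this converts
    between being the predecessor of [b] and being the successor of [a]. *)
Lemma gap_le_sym {R : realType} (a b m : R) :
  phases a -> phases b -> phases m ->
  (gap a b <= gap m b) = (gap a b <= gap a m).
Proof.
move=> ha hb hm; have := gap_split ha hm hb; have /andP[? ?] := gap_itv ha hm.
by case: ifP => [|/negbT]; rewrite -?leNgt => ? ?; apply/idP/idP => ?; lra.
Qed.

(** Forward from [x], the phase [b] comes within half the gap and before any other [m]; backward,
    [m] is no closer than [a], at least half the gap away. At the midpoint itself the distances may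
    tie, hence the second conclusion. *)
Lemma half_arc_before {R : realType} (a b m x : R) :
  phases a -> phases b -> phases m -> phases x ->
  gap a b <= gap m b -> phase_arc (midpoint a b) b x ->
  delta b x <= delta m x /\ (m <> b -> gap x b < gap x m).
Proof.
move=> ha hb hm hx hab.
have hs := midpoint_phases a b; have gs := gap_midpointl ha hb.
rewrite phase_arc_gap // => hsx.
have xb : x != b.
  by apply/eqP => xb; move: hsx; rewrite {}xb ltxx => -[sb|//]; move: gs;
     rewrite -sb gapxx //; have /andP[_ ?] := gap_itv ha hb;
     have ? := @pi_gt0 R => ?; lra.
have gxb : gap x b <= gap a b / 2.
  case: hsx => [->|lt_x]; first by rewrite gs.
  by have := gap_split hs hx hb; rewrite lt_x gs;
     have /andP[? _] := gap_itv hs hx => ?; lra.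
have /andP[g0 g1] := gap_itv ha hb.
have [->|/eqP nmb] := eqVneq m b; first by split.
have hxm : gap x b < gap x m.
  rewrite ltNge; apply/negP; rewrite le_eqVlt => /predU1P[|lt_m].
    by move/(gap_injr hx hm hb).
  by have := gap_split hx hm hb; rewrite lt_m;
     have /andP[? _] := gap_itv hx hm => ?; lra.
split=> // {nmb}.
have [mx|nmx] := eqVneq m x; first by rewrite mx in hab; lra.
rewrite eq_sym in xb; rewrite (delta_gap hb hx xb) (delta_gap hm hx nmx) ge_min.
apply/orP; right; rewrite le_min (ltW hxm) andbT.
have := gap_split hm hx hb; case: ltP => ? ?; first by lra.
by have /andP[_ ?] := gap_itv hm hb; lra.
Qed.

(** Strict, unlike the previous case, because this half excludes the midpoint. *)
Lemma half_arc_after {R : realType} (a b m x : R) :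
  phases a -> phases b -> phases m -> phases x ->
  gap a b <= gap m b -> phase_arc a (midpoint a b) x -> m <> a ->
  delta a x < delta m x.
Proof.
move=> ha hb hm hx; rewrite gap_le_sym // => hab.
have hs := midpoint_phases a b; have gs := gap_midpointr ha hb.
have /andP[g0 g1] := gap_itv ha hb.
rewrite phase_arc_gap // gs => hax /eqP nma.
have [xa|nxa] := eqVneq x a.
  rewrite xa deltaxx // delta_gap // lt_min.
  by have /andP[-> _] := gap_itv ha hm; have /andP[-> _] := gap_itv hm ha.
have {}hax : gap a x < gap a b / 2 by case: hax => // /eqP; rewrite (negbTE nxa).
have nmx : m != x by apply/eqP => mx; rewrite mx in hab; lra.
rewrite eq_sym in nxa; rewrite (delta_gap ha hx nxa)
  (delta_gap hm hx nmx) gt_min !lt_min.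
have h1 := gap_split ha hx hm; have h2 := gapC hm hx nmx; have h3 := gapC ha hm.
move: h1; rewrite ifT => [h1|]; last by lra.
rewrite eq_sym in nma; have {}h3 := h3 nma.
have /andP[? _] := gap_itv hm ha.
by apply/orP; left; apply/andP; split; lra.
Qed.

(** * Sub-areas as Voronoi cells *)

Lemma gap_lt_2pi {R : realType} (a b : R) : phases a -> phases b -> a <> b ->
  gap a b < 2 * pi.
Proof.
move=> ha hb /eqP nab; have := gapC ha hb nab; have /andP[? _] := gap_itv hb ha.
by move=> ?; lra.
Qed.

Lemma delta_midpointr {R : realType} (a b : R) : phases a -> phases b ->
  delta a (midpoint a b) = gap a b / 2.
Proof.
move=> ha hb; have hs := midpoint_phases a b; have gs := gap_midpointr ha hb.
have /andP[? ?] := gap_itv ha hb.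
have nas : a != midpoint a b.
  by apply/eqP => e; move: gs; rewrite -e gapxx // => ?; lra.
have := gapC ha hs nas => ?.
by rewrite delta_gap // -gs; apply/min_idPl; lra.
Qed.

Lemma delta_midpointl {R : realType} (a b : R) : phases a -> phases b ->
  delta (midpoint a b) b = gap a b / 2.
Proof.
move=> ha hb; have hs := midpoint_phases a b; have gs := gap_midpointl ha hb.
have /andP[? ?] := gap_itv ha hb.
have nbs : midpoint a b != b.
  by apply/eqP => e; move: gs; rewrite e gapxx // => ?; lra.
have := gapC hs hb nbs => ?.
by rewrite delta_gap // -gs; apply/min_idPl; lra.
Qed.

(** The bound by one turn keeps the two arcs around [p] from overlapping. Equality occurs when [a]
    and [b] coincide, that is for two agents on a layer. *)
Lemma gap_midpointD {R : realType} (a p b : R) :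
  phases a -> phases p -> phases b -> gap a p + gap p b <= 2 * pi ->
  gap (midpoint a p) p + gap p (midpoint p b) = gap (midpoint a p) (midpoint p b).
Proof.
move=> ha hp hb; have hs := midpoint_phases a p; have ht := midpoint_phases p b.
have := gap_split hs hp ht; rewrite gap_midpointl // gap_midpointr //.
have /andP[? _] := gap_itv hs ht; have ? := @pi_gt0 R.
by case: ifP => // _ ? ?; lra.
Qed.

Section Cells.
Context {R : realType} {K : nat} {A : finType}.
Implicit Types (c : configuration R K A) (j : 'I_K) (l m : A).

Lemma worker_layer c j l m : l \in workers c j ->
  (layer c m == layer c l) = (m \in workers c j).
Proof. by rewrite !inE => /eqP ->. Qed.

Lemma pred_agentP c j l : l \in workers c j ->
  pred_agent c l \in workers c j /\
  forall m, m \in workers c j ->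
    gap (phase c (pred_agent c l)) (phase c l) <= gap (phase c m) (phase c l).
Proof.
move=> hl; rewrite /pred_agent; case: arg_minP => [|m]; first exact: eqxx.
rewrite (worker_layer _ hl) => hm hmin; split=> // m' hm'; apply: hmin.
by rewrite (worker_layer _ hl).
Qed.

Lemma succ_agentP c j l : l \in workers c j ->
  succ_agent c l \in workers c j /\
  forall m, m \in workers c j ->
    gap (phase c l) (phase c (succ_agent c l)) <= gap (phase c l) (phase c m).
Proof.
move=> hl; rewrite /succ_agent; case: arg_minP => [|m]; first exact: eqxx.
rewrite (worker_layer _ hl) => hm hmin; split=> // m' hm'; apply: hmin.
by rewrite (worker_layer _ hl).
Qed.

Lemma worker_phases c j l : valid c -> l \in workers c j -> phases (phase c l).
Proof. by case=> h _ /h. Qed.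

Lemma worker_phase_inj c j l m : valid c -> l \in workers c j ->
  m \in workers c j -> l <> m -> phase c l <> phase c m.
Proof. by case=> _ h hl hm nlm /(h _ _ _ hl hm). Qed.

(** [pred_agent] is known only as a minimiser of the gap; injectivity of [gap] in its first argument
    identifies its phase with that of any other minimiser. *)
Lemma division_adjacent c j l m : valid c ->
  l \in workers c j -> m \in workers c j ->
  (forall m', m' \in workers c j ->
     gap (phase c l) (phase c m) <= gap (phase c m') (phase c m)) ->
  division c m = midpoint (phase c l) (phase c m).
Proof.
move=> hc hl hm hmin; rewrite /division.
have [hp pmin] := pred_agentP hm.
congr midpoint; apply: (@gap_injl _ (phase c m));
  do 1?exact: (worker_phases hc (j := j)).
by apply/le_anti; rewrite pmin // hmin.
Qed.

Lemma division_nextE c j l : valid c -> l \in workers c j ->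
  division_next c l = midpoint (phase c l) (phase c (succ_agent c l)).
Proof.
move=> hc hl; have [hs smin] := succ_agentP hl.
apply: (division_adjacent hc hl hs) => m hm.
by rewrite gap_le_sym ?smin //; apply: (worker_phases hc (j := j)).
Qed.

Lemma division_phases c l : phases (division c l).
Proof. exact: midpoint_phases. Qed.

(** The gap from an agent to itself is 2 pi, larger than the gap from any other agent, so
    self-neighbours occur only for a lone agent. *)
Lemma pred_agent_neq c j l m : valid c -> l \in workers c j ->
  m \in workers c j -> m <> l -> pred_agent c l <> l.
Proof.
move=> hc hl hm nml e; have [_ /(_ _ hm)] := pred_agentP hl.
have hl' := worker_phases hc hl; have hm' := worker_phases hc hm.
by rewrite e gapxx // leNgt gap_lt_2pi //; apply: (worker_phase_inj hc hm).
Qed.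

Lemma succ_agent_neq c j l m : valid c -> l \in workers c j ->
  m \in workers c j -> m <> l -> succ_agent c l <> l.
Proof.
move=> hc hl hm nml e; have [_ /(_ _ hm)] := succ_agentP hl.
have hl' := worker_phases hc hl; have hm' := worker_phases hc hm.
rewrite e gapxx // leNgt gap_lt_2pi //.
by apply: (worker_phase_inj hc hl hm) => lm; apply: nml.
Qed.

(** The predecessor is at least as close behind [l] as the successor is, and the two gaps between
    [l] and its successor add up to one turn. *)
Lemma gap_neighbours c j l m : valid c -> l \in workers c j ->
  m \in workers c j -> m <> l ->
  gap (phase c (pred_agent c l)) (phase c l)
    + gap (phase c l) (phase c (succ_agent c l)) <= 2 * pi.
Proof.
move=> hc hl hm nml; have [hp pmin] := pred_agentP hl.
have [hs _] := succ_agentP hl.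
have nsl := succ_agent_neq hc hl hm nml.
have hl' := worker_phases hc hl; have hs' := worker_phases hc hs.
have /eqP nsl' := worker_phase_inj hc hs hl nsl.
by have := gapC hs' hl' nsl'; have := pmin _ hs => ? ?; lra.
Qed.

Lemma gap_subarea c j l : valid c -> l \in workers c j ->
  gap (division c l) (phase c l) + gap (phase c l) (division_next c l)
  = gap (division c l) (division_next c l).
Proof.
move=> hc hl; have [hp pmin] := pred_agentP hl; have [hs smin] := succ_agentP hl.
rewrite (division_nextE hc hl) /division.
have hl' := worker_phases hc hl.
have [e|/eqP npl] := eqVneq (pred_agent c l) l; last first.
  by apply: gap_midpointD (gap_neighbours hc hl hp npl);
     apply: (worker_phases hc (j := j)).
(* A lone agent: the neighbouring gaps sum to two turns, so [gap_midpointD] does not apply. Both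
   division points are the antipode of the agent, and their gap is the whole circle. *)
have [->|/eqP nsl] := eqVneq (succ_agent c l) l.
  by rewrite e gap_midpointl // gap_midpointr // !gapxx //;
     [lra|exact: midpoint_phases].
by have := pred_agent_neq hc hl hs nsl.
Qed.

Lemma subarea_split c j l x : valid c -> l \in workers c j -> phases x ->
  (subarea c l x <-> subarea2 c l x \/ subarea3 c l x) /\
  ~ (subarea2 c l x /\ subarea3 c l x).
Proof.
move=> hc hl hx; apply: phase_arc_split (gap_subarea hc hl) => //.
- exact: division_phases.
- exact: worker_phases hl.
- exact: division_phases.
Qed.

Lemma subarea2_nearest c j l m x : valid c -> l \in workers c j ->
  m \in workers c j -> subarea2 c l x ->
  delta (phase c l) x <= delta (phase c m) x /\
  (m <> l -> gap x (phase c l) < gap x (phase c m)).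
Proof.
move=> hc hl hm; rewrite /subarea2 /division => hx.
have [hp pmin] := pred_agentP hl.
have px : phases x by case: hx.
have [h1 h2] := half_arc_before (worker_phases hc hp) (worker_phases hc hl)
  (worker_phases hc hm) px (pmin _ hm) hx.
split=> // nml; apply: h2; exact: worker_phase_inj hm hl nml.
Qed.

Lemma subarea3_nearest c j l m x : valid c -> l \in workers c j ->
  m \in workers c j -> subarea3 c l x -> m <> l ->
  delta (phase c l) x < delta (phase c m) x.
Proof.
move=> hc hl hm; rewrite /subarea3 (division_nextE hc hl) => hx nml.
have [hs smin] := succ_agentP hl.
have px : phases x by case: hx.
have pl := worker_phases hc hl; have pm := worker_phases hc hm.
have ps := worker_phases hc hs.
apply: (half_arc_after pl ps pm px _ hx (worker_phase_inj hc hm hl nml)).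
by rewrite gap_le_sym ?smin.
Qed.

Lemma subarea_nearest c j l m x : valid c -> l \in workers c j ->
  m \in workers c j -> subarea c l x ->
  delta (phase c l) x <= delta (phase c m) x.
Proof.
move=> hc hl hm hx; have px : phases x by case: hx.
have [/iffLR/(_ hx)[h|h] _] := subarea_split hc hl px.
  by have [] := subarea2_nearest hc hl hm h.
have [->//|/eqP nml] := eqVneq m l.
by rewrite ltW // (subarea3_nearest hc hl hm).
Qed.

(** A point shared by two agents is equally far from both, so strictness excludes it from either
    [subarea3]. In both [subarea2] each agent would have to come strictly first after [x]. *)
Lemma subarea_inj c j l m x : valid c -> l \in workers c j ->
  m \in workers c j -> subarea c l x -> subarea c m x -> l = m.
Proof.
move=> hc hl hm hxl hxm; have px : phases x by case: hxl.
apply: contrapT => nlm; have nml : m <> l by move=> ?; apply: nlm.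
have near_l := subarea_nearest hc hl hm hxl.
have near_m := subarea_nearest hc hm hl hxm.
have [/iffLR/(_ hxl)[l2|l3] _] := subarea_split hc hl px; last first.
  by have := subarea3_nearest hc hl hm l3 nml; rewrite ltNge near_m.
have [/iffLR/(_ hxm)[m2|m3] _] := subarea_split hc hm px; last first.
  by have := subarea3_nearest hc hm hl m3 nlm; rewrite ltNge near_l.
have [_ /(_ nml)] := subarea2_nearest hc hl hm l2.
have [_ /(_ nlm)] := subarea2_nearest hc hm hl m2.
by move=> /lt_trans h /h; rewrite ltxx.
Qed.

(* The owner of [x] is the agent whose division point comes last before [x]. *)
Lemma subarea_cover c j m x : valid c -> m \in workers c j -> phases x ->
  exists2 l, l \in workers c j & subarea c l x.
Proof.
move=> hc hm hx; pose w l := mod2pi (x - division c l).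
case: (@arg_minP _ _ _ m (fun l => l \in workers c j) w hm) => l hl hmin.
exists l => //; split=> //.
have [hs _] := succ_agentP hl; have := hmin _ hs; rewrite /w /division_next.
have := division_phases c l; have := division_phases c (succ_agent c l).
move: (division c l) (division c (succ_agent c l)) => a b hb ha.
rewrite !mod2piB // gapE //; move: ha hb hx; rewrite !phasesE.
move=> /andP[? ?] /andP[? ?] /andP[? ?].
case: (ltP a b) => ?; case: (leP a x) => ?; case: (leP b x) => ? ?; lra.
Qed.

End Cells.

(** * Integrals against a density *)

Section WeightedIntegral.
Context {disp : measure_display} {T : measurableType disp} {R : realType}.
Variables (mu : {measure set T -> \bar R}) (D : set T) (rho : T -> R).
Hypotheses (mD : measurable D) (irho : mu.-integrable D (EFin \o rho)).
Implicit Types g h : T -> R.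

(** The class of factors whose product with an integrable [rho] stays integrable. Both conditions
    are restricted to [D] because [f] and [d] are controlled only on phases. *)
Definition bounded_measurable g :=
  measurable_fun D g /\ exists M : R, forall x, D x -> `|g x| <= M.

Lemma bounded_measurable_indic U : measurable U -> bounded_measurable \1_U.
Proof.
move=> mU; split; first exact: measurable_indic.
by exists 1 => x _; rewrite indicE ger0_norm //; case: (_ \in _).
Qed.

Lemma bounded_measurable0 : bounded_measurable (fun=> 0).
Proof. by split; [exact: measurable_cst | exists 0 => x _; rewrite normr0]. Qed.

Lemma bounded_measurableD g h :
  bounded_measurable g -> bounded_measurable h ->
  bounded_measurable (fun x => g x + h x).
Proof.
move=> [mg [M gM]] [mh [N hN]]; split; first exact: measurable_funD.
by exists (M + N) => x Dx; rewrite (le_trans (ler_normD _ _)) // lerD ?gM ?hN.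
Qed.

Lemma bounded_measurableB g h :
  bounded_measurable g -> bounded_measurable h ->
  bounded_measurable (fun x => g x - h x).
Proof.
move=> bg [mh [N hN]]; apply: bounded_measurableD bg _; split.
  exact: measurableT_comp.
by exists N => x Dx; rewrite normrN hN.
Qed.

Lemma bounded_measurableM g h :
  bounded_measurable g -> bounded_measurable h ->
  bounded_measurable (fun x => g x * h x).
Proof.
move=> [mg [M gM]] [mh [N hN]]; split; first exact: measurable_funM.
by exists (M * N) => x Dx; rewrite normrM ler_pM ?gM ?hN.
Qed.

Lemma weighted_integrable g :
  bounded_measurable g -> mu.-integrable D (EFin \o (fun x => g x * rho x)).
Proof.
move=> [mg [M gM]].
rewrite (_ : EFin \o _ = (EFin \o g) \* (EFin \o rho))%E //.
apply: integrableMr irho => //; exists M; split; first exact: num_real.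
by move=> N MN x Dx; exact: le_trans (gM _ Dx) (ltW MN).
Qed.

Lemma weighted_integralD g h : bounded_measurable g -> bounded_measurable h ->
  \int[mu]_(x in D) ((g x + h x) * rho x)
  = \int[mu]_(x in D) (g x * rho x) + \int[mu]_(x in D) (h x * rho x).
Proof.
move=> bg bh; under eq_Rintegral do rewrite mulrDl.
by apply: RintegralD => //; exact: weighted_integrable.
Qed.

Lemma weighted_integralB g h : bounded_measurable g -> bounded_measurable h ->
  \int[mu]_(x in D) ((g x - h x) * rho x)
  = \int[mu]_(x in D) (g x * rho x) - \int[mu]_(x in D) (h x * rho x).
Proof.
move=> bg bh; under eq_Rintegral do rewrite mulrBl.
by apply: RintegralB => //; exact: weighted_integrable.
Qed.

(** Both conclusions are proved together, since additivity at each induction step needs the tail to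
    be bounded and measurable. *)
Lemma weighted_integral_sum (I : Type) (s : seq I) (P : pred I) (g : I -> T -> R) :
  (forall l, P l -> bounded_measurable (g l)) ->
  bounded_measurable (fun x => \sum_(l <- s | P l) g l x) /\
  \int[mu]_(x in D) ((\sum_(l <- s | P l) g l x) * rho x)
  = \sum_(l <- s | P l) \int[mu]_(x in D) (g l x * rho x).
Proof.
move=> bg; elim: s => [|l s [IHb IHe]].
  rewrite big_nil; under eq_fun do rewrite big_nil.
  split; first exact: bounded_measurable0.
  under eq_Rintegral do rewrite big_nil mul0r.
  by rewrite Rintegral_cst // mul0r.
rewrite big_cons; have [Pl|nPl] := boolP (P l); last first.
  under eq_fun do rewrite big_cons (negbTE nPl).
  split=> //; under eq_Rintegral do rewrite big_cons (negbTE nPl).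
  exact: IHe.
under eq_fun do rewrite big_cons Pl.
split; first by apply: bounded_measurableD => //; exact: bg.
under eq_Rintegral do rewrite big_cons Pl.
by rewrite weighted_integralD ?IHe //; exact: bg.
Qed.

(** Brings integrals over different arcs to one common domain, where their integrands can be
    compared pointwise. *)
Lemma weighted_integral_indic (U : set T) g : U `<=` D ->
  \int[mu]_(x in U) (g x * rho x) = \int[mu]_(x in D) ((\1_U x * g x) * rho x).
Proof.
move=> UD; rewrite -{1}(setIidr UD) Rintegral_mkcondr.
by apply: eq_Rintegral => x _;
   rewrite indic_restrict !patchE /=; case: ifP; rewrite ?mul1r ?mul0r.
Qed.

Lemma le_weighted_integral g h : (forall x, D x -> 0 <= rho x) ->
  bounded_measurable g -> bounded_measurable h ->
  (forall x, D x -> g x <= h x) ->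
  \int[mu]_(x in D) (g x * rho x) <= \int[mu]_(x in D) (h x * rho x).
Proof.
move=> rho0 bg bh gh; apply: le_Rintegral => // [||x Dx].
- exact: weighted_integrable.
- exact: weighted_integrable.
- by rewrite ler_wpM2r ?gh ?rho0.
Qed.

(** A zero integral would force [g * rho] to vanish almost everywhere; as [g] has only negligible
    zeros, [rho] itself would vanish almost everywhere and have no mass. *)
Lemma weighted_integral_gt0 g : (forall x, D x -> 0 <= rho x) ->
  0 < \int[mu]_(x in D) rho x ->
  bounded_measurable g -> (forall x, D x -> 0 <= g x) ->
  mu.-negligible [set x | D x /\ g x = 0] ->
  0 < \int[mu]_(x in D) (g x * rho x).
Proof.
move=> rho0 Irho bg g0 ng; rewrite lt_neqAle Rintegral_ge0 ?andbT; last first.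
  by move=> x Dx; rewrite mulr_ge0 ?g0 ?rho0.
apply/eqP => /esym I0; have ig := weighted_integrable bg.
suff : \int[mu]_(x in D) rho x = 0 by move=> e; rewrite e ltxx in Irho.
have mg := measurable_int mu ig.
have h0 : (\int[mu]_(x in D) `|(g x * rho x)%:E| = 0)%E.
  under eq_integral => x /set_mem Dx.
    rewrite gee0_abs ?lee_fin ?mulr_ge0 ?g0 ?rho0 //; over.
  by rewrite -[LHS]fineK ?integrable_fin_num // -[fine _]/(Rintegral _ _ _) I0.
have gr0 := (ae_eq_integral_abs mu mD mg).1 h0.
have rho_ae0 : ae_eq mu D (EFin \o rho) (cst 0%E).
  have ng' : \forall x \ae mu, D x -> g x <> 0.
    by apply: negligibleS ng => x /= /not_implyP[Dx /contrapT].
  apply: filterS2 gr0 ng' => x /= gr ngx Dx; case: (gr Dx) => /eqP.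
  by rewrite mulf_eq0 => /orP[/eqP gx0|/eqP ->] //; case: (ngx Dx).
rewrite /Rintegral (ae_eq_integral (cst 0%E)) //; first by rewrite integral0.
exact: measurable_int irho.
Qed.

End WeightedIntegral.

(** * Layer probabilities *)

(* [lebesgue_measure] lives on [measurableTypeR R], whose display is not that of
   the default measurable structure of [R]; without the annotation the latter is
   inferred. *)
Lemma measurable_phases {R : realType} :
  measurable (phases : set (measurableTypeR R)).
Proof. exact: measurable_itv. Qed.

Lemma measurable_phase_arc {R : realType} (a b : R) : phases a -> phases b ->
  measurable (phase_arc a b : set (measurableTypeR R)).
Proof.
move=> ha hb.
(* The second interval is the first one moved back by a turn: it carries the part of the arc that
   wraps past phase 0. *)
rewrite (_ : phase_arc a b = phases `&`
  (`[a, a + gap a b[ `|` `[a - 2 * pi, a - 2 * pi + gap a b[)).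
  by apply: measurableI; [exact: measurable_phases|apply: measurableU].
have /andP[? ?] := gap_itv ha hb; apply/seteqP; split=> x /=.
  move=> hx; have px : phases x by case: hx.
  split=> //; move: hx; rewrite phase_arcE // !in_itv /=.
  move: ha px; rewrite !phasesE => /andP[? ?] /andP[? ?].
  by case: (leP a x) => ? ?; [left|right]; apply/andP; split; lra.
case=> px; rewrite phase_arcE // !in_itv /=.
move: ha px; rewrite !phasesE => /andP[? ?] /andP[? ?].
by case: (leP a x) => ? [] /andP[? ?]; lra.
Qed.

(** A closed form without case distinction, from which measurability of the distance is read off. *)
Lemma delta_minE {R : realType} (x y : R) : phases x -> phases y ->
  delta x y = Num.min `|x - y| (2 * pi - `|x - y|).
Proof.
move=> hx hy; rewrite deltaE //; move: hx hy; rewrite !phasesE.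
move=> /andP[? ?] /andP[? ?]; rewrite minEle; case: (leP x y) => ?.
  rewrite ler0_norm; last by lra.
  by case: (ltP _ pi) => ?; case: (leP _ (2 * pi - _)) => ?; lra.
rewrite ger0_norm; last by lra.
by case: (leP _ pi) => ?; case: (leP _ (2 * pi - _)) => ?; lra.
Qed.

Lemma delta_le_pi {R : realType} (x y : R) : phases x -> phases y ->
  delta x y <= pi.
Proof.
move=> hx hy; rewrite delta_minE // ge_min.
by case: (leP `|x - y| pi) => //= ?; lra.
Qed.

(** * Distance and detection as functions of the phase *)

Section Detection.
Context {R : realType}.
Variables (d : R -> R -> R) (f : R -> R).
Hypotheses (hd : distance_function d) (hf : detection_function d f).

Lemma dist_ge0 x y : phases x -> phases y -> 0 <= d x y.
Proof.
case: hd => _ [c c0 dE] hx hy.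
by rewrite dE // mulr_ge0 ?delta_ge0 // ltW.
Qed.

Lemma distxx x : phases x -> d x x = 0.
Proof. by case: hd => _ [c c0 dE] hx; rewrite dE // deltaxx // mulr0. Qed.

Lemma dist_gt0 x y : phases x -> phases y -> x <> y -> 0 < d x y.
Proof.
case: hd => _ [c c0 dE] hx hy /eqP xy; rewrite dE // mulr_gt0 //.
rewrite delta_gap // lt_min.
by have /andP[-> _] := gap_itv hx hy; have /andP[-> _] := gap_itv hy hx.
Qed.

Lemma le_dist x y z : phases x -> phases y -> phases z ->
  delta x z <= delta y z -> d x z <= d y z.
Proof.
case: hd => _ [c c0 dE] hx hy hz h.
by rewrite !dE // ler_pM2l.
Qed.

(** The detour from [a] to [x] through [s], with its first leg replaced by the equal distance from
    [s] to [b]. This produces the arguments of [f] in the departure quantity. *)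
Lemma dist_triangle_midpoint a b s x :
  phases a -> phases b -> phases s -> phases x -> delta a s = delta s b ->
  d a x <= d s b + d s x.
Proof.
case: hd => _ [c c0 dE] ha hb hs hx asb.
rewrite !dE // -mulrDr ler_pM2l // -asb.
exact: delta_triangle.
Qed.

Lemma detection_anti x y : 0 <= x -> x <= y -> f y <= f x.
Proof.
case: hf => _ fd _ x0; rewrite le_eqVlt => /predU1P[->//|xy].
by rewrite ltW // fd.
Qed.

Lemma detection_ge0 x y : phases x -> phases y -> 0 <= f (d x y).
Proof. by case: hf => _ _ h hx hy; have /andP[] := h _ _ hx hy. Qed.

Lemma detection_lt1 x y : phases x -> phases y -> x <> y -> f (d x y) < 1.
Proof.
case: hf => _ fd h hx hy xy; have /andP[_] := h _ _ hx hx.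
by apply: lt_le_trans; rewrite distxx // fd // dist_gt0.
Qed.

Lemma detection_le1 x y : phases x -> phases y -> f (d x y) <= 1.
Proof. by case: hf => _ _ h hx hy; have /andP[] := h _ _ hx hy. Qed.

(** The offset [e] stands for the distance from a division point to the departing agent. *)
Lemma bounded_measurable_detectionD e s : 0 <= e -> phases s ->
  bounded_measurable (phases : set (measurableTypeR R))
    (fun x => f (e + d s x)).
Proof.
move=> e0 hs; split.
  have [c c0 dE] := hd.2.
  (* Extending [f] by the constant [f 0] on the negatives makes it monotone on the whole line, hence
     measurable. *)
  pose f0 y := f (Num.max y 0).
  pose g x := e + c * Num.min `|s - x| (2 * pi - `|s - x|).
  apply: (@eq_measurable_fun _ _ _ _ _ (f0 \o g)).
    move=> x /set_mem hx; rewrite /f0 /g /= -delta_minE // -dE //.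
    by rewrite max_l // addr_ge0 ?dist_ge0.
  have mf0 : measurable_fun setT f0.
    apply: nonincreasing_measurable => // x y xy; apply: detection_anti.
      by rewrite le_max lexx orbT.
    by rewrite ge_max !le_max xy lexx /= orbT.
  apply: measurableT_comp mf0 _.
  have mn : measurable_fun phases (fun x : R => `|s - x|).
    by apply: measurableT_comp => //; apply: measurable_funB.
  apply: measurable_funD => //; apply: measurable_funM => //.
  by apply: measurable_minr => //; apply: measurable_funB.
have [c c0 dE] := hd.2.
(* With an offset the argument may exceed every actual distance, so the bounds 0 and 1 on [f] do not
   apply; monotonicity places the value between [f (e + c * pi)] and [f 0]. *)
exists (`|f 0| + `|f (e + c * pi)|) => x hx.
have h0 : 0 <= e + d s x by rewrite addr_ge0 ?dist_ge0.
have := detection_anti (lexx 0) h0.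
have : e + d s x <= e + c * pi by rewrite lerD2l dE // ler_pM2l // delta_le_pi.
move=> /(detection_anti h0) h1 h2.
have [? ?] := (ler_norm (f 0), ler_normr (f (e + c * pi)) (- f (e + c * pi))).
have ? : - f (e + c * pi) <= `|f (e + c * pi)| by rewrite -normrN ler_norm.
have ? : 0 <= `|f (e + c * pi)| by [].
have ? : 0 <= `|f 0| by [].
by rewrite ler_norml; apply/andP; split; lra.
Qed.

Lemma bounded_measurable_detection s : phases s ->
  bounded_measurable (phases : set (measurableTypeR R))
    (fun x => f (d s x)).
Proof.
move=> hs; have := bounded_measurable_detectionD (lexx 0) hs.
by under eq_fun do rewrite add0r.
Qed.

(** * Pointwise coverage of a layer, and the layer probability as its integral *)

Context {K : nat} {A : finType}.
Implicit Types (c : configuration R K A) (j : 'I_K) (l m : A).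

(** At most one term is nonzero, as the sub-areas are disjoint; the sum of indicators allows
    termwise integration and gives 0 on an empty layer. *)
Definition coverage c j (x : R) : R :=
  \sum_(l in workers c j) \1_(subarea c l) x * f (d (phase c l) x).

Lemma coverage_subarea c j l x : valid c -> l \in workers c j ->
  subarea c l x -> coverage c j x = f (d (phase c l) x).
Proof.
move=> hc hl hx; rewrite /coverage (bigD1 l) //= big1 ?addr0.
  by rewrite indicE mem_set // mul1r.
move=> m /andP[hm /eqP nml]; rewrite indicE memNset ?mul0r // => hxm.
by apply: nml; exact: subarea_inj hc hm hl hxm hx.
Qed.

(** The owner of [x] is at least as near as [m], and [f] decreases. The free bound [u] leaves room
    for a triangle-inequality detour. *)
Lemma coverage_ge c j m x u : valid c -> m \in workers c j -> phases x ->
  d (phase c m) x <= u -> f u <= coverage c j x.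
Proof.
move=> hc hm hx mu; have [l hl xl] := subarea_cover hc hm hx.
have pl := worker_phases hc hl; have pm := worker_phases hc hm.
rewrite (coverage_subarea hc hl xl); apply: detection_anti (dist_ge0 _ _) _ => //.
by apply: le_trans mu; apply: le_dist => //; exact: subarea_nearest hc hl hm xl.
Qed.

(** Extra agents can only bring the nearest one closer; the division points of the two
    configurations never have to be compared. *)
Lemma coverage_mono c c' j x : valid c -> valid c' -> phases x ->
  (forall l, l \in workers c j -> l \in workers c' j /\ phase c' l = phase c l) ->
  coverage c j x <= coverage c' j x.
Proof.
move=> hc hc' hx sub.
have [e|[m hm]] := set_0Vmem (workers c j).
  rewrite {1}/coverage e big_set0.
  have [e'|[m hm]] := set_0Vmem (workers c' j).
    by rewrite /coverage e' big_set0.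
  have [l hl xl] := subarea_cover hc' hm hx.
  rewrite (coverage_subarea hc' hl xl).
  by apply: detection_ge0 => //; exact: worker_phases hl.
have [l hl xl] := subarea_cover hc hm hx.
have [hl' e] := sub _ hl.
by rewrite (coverage_subarea hc hl xl); apply: (coverage_ge hc' hl' hx); rewrite e.
Qed.

Lemma coverage_le1 c j x : valid c -> phases x -> coverage c j x <= 1.
Proof.
move=> hc hx; have [e|[m hm]] := set_0Vmem (workers c j).
  by rewrite /coverage e big_set0.
have [l hl xl] := subarea_cover hc hm hx.
rewrite (coverage_subarea hc hl xl).
by apply: detection_le1 => //; exact: worker_phases hl.
Qed.

Lemma coverage_eq1 c j x : valid c -> phases x -> coverage c j x = 1 ->
  exists l, phase c l = x.
Proof.
move=> hc hx; have [e|[m hm]] := set_0Vmem (workers c j).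
  by rewrite /coverage e big_set0 => /esym/eqP; rewrite oner_eq0.
have [l hl xl] := subarea_cover hc hm hx.
rewrite (coverage_subarea hc hl xl) => e; exists l; apply: contrapT => nlx.
have := detection_lt1 (worker_phases hc hl) hx nlx.
by rewrite e ltxx.
Qed.

Lemma bounded_measurable_arc_detection a b s : phases a -> phases b -> phases s ->
  bounded_measurable (phases : set (measurableTypeR R))
    (fun x => \1_(phase_arc a b) x * f (d s x)).
Proof.
move=> ha hb hs; apply: bounded_measurableM.
  by apply: bounded_measurable_indic; exact: measurable_phase_arc.
exact: bounded_measurable_detection.
Qed.

Variables (rho : R -> R).
Hypothesis hrho : intrusion_density rho.
Local Notation mu := (@lebesgue_measure R).

Lemma integrable_density : mu.-integrable phases (EFin \o rho).
Proof.
case: hrho => mrho rho0 Irho; apply/integrableP; split.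
  exact/measurable_EFinP.
have -> : (\int[mu]_(x in phases) `|(EFin \o rho) x| = 1)%E; last by rewrite ltry.
rewrite -Irho; apply: eq_integral => x /set_mem hx.
by rewrite gee0_abs // lee_fin rho0.
Qed.

Lemma phase_arc_sub (a b : R) : phase_arc a b `<=` phases.
Proof. by move=> x []. Qed.

Lemma layer_probE c j : valid c ->
  bounded_measurable (phases : set (measurableTypeR R)) (coverage c j) /\
  layer_prob d f rho c j = \int[mu]_(x in phases) (coverage c j x * rho x).
Proof.
move=> hc; have bl l : l \in workers c j ->
    bounded_measurable (phases : set (measurableTypeR R))
    (fun x => \1_(subarea c l) x * f (d (phase c l) x)).
  move=> hl; apply: bounded_measurable_arc_detection; try exact: division_phases.
  exact: worker_phases hl.
have [] := weighted_integral_sum measurable_phases integrable_density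
  (index_enum A) bl.
move=> bc Ic; split=> //; rewrite /coverage Ic /layer_prob.
apply: eq_bigr => l _; apply: weighted_integral_indic; exact: phase_arc_sub.
Qed.

Lemma layer_prob_lt1 c j : valid c -> layer_prob d f rho c j < 1.
Proof.
move=> hc; have [bc ->] := layer_probE j hc.
have [_ rho0 Irho] := hrho.
have Irho1 : \int[mu]_(x in phases) rho x = 1 by rewrite /Rintegral Irho.
have b1 : bounded_measurable (phases : set (measurableTypeR R))
    (fun=> 1 : R).
  by split=> //; exists 1 => x _; rewrite normr1.
have I1 : \int[mu]_(x in phases) (1 * rho x) = 1.
  by under eq_Rintegral do rewrite mul1r.
rewrite -subr_gt0 -[X in X - _]I1.
rewrite -(weighted_integralB measurable_phases integrable_density b1 bc).
apply: (weighted_integral_gt0 measurable_phases integrable_density rho0).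
- by rewrite Irho1.
- exact: bounded_measurableB.
- by move=> x hx; rewrite subr_ge0 coverage_le1.
(* Coverage equals 1 only where some agent stands, hence at finitely many phases. *)
apply: (@negligibleS _ _ _ mu (range (phase c))).
  move=> x [hx /eqP]; rewrite subr_eq0 => /eqP/esym.
  by move/(coverage_eq1 hc hx) => [l <-]; exists l.
have fin : finite_set (range (phase c)) by apply: finite_image; exact: finite_finset.
apply/negligibleP; last exact: countable_lebesgue_measure0 (finite_set_countable fin).
exact: countable_measurable (finite_set_countable fin).
Qed.

End Detection.

(** * Departure and entry *)

Lemma gapD_le {R : realType} (a p b : R) : phases a -> phases p -> phases b ->
  gap a p + gap p b <= 2 * pi -> gap a b = gap a p + gap p b.
Proof.
move=> ha hp hb; have := gap_split ha hp hb; have /andP[? _] := gap_itv ha hb.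
by case: ifP => // _ ? ?; lra.
Qed.

(** With [p] ignored, its neighbours [a] and [b] become adjacent: an [m] strictly between them would
    lie on one side of [p] and beat [a] or [b] as neighbour of [p]. *)
Lemma gap_adjacent_le {R : realType} (a p b m : R) :
  phases a -> phases p -> phases b -> phases m -> m <> p ->
  gap a p + gap p b <= 2 * pi -> gap a p <= gap m p -> gap p b <= gap p m ->
  gap a b <= gap m b.
Proof.
move=> ha hp hb hm /eqP nmp /(gapD_le ha hp hb) -> amp pbm.
have := gap_split hm hp hb; have := gapC hm hp nmp.
by have /andP[? _] := gap_itv hm hb; case: ifP => _ ? ?; lra.
Qed.

(** The old division point, the midpoint of [a] and [b], falls between the two new ones, because
    half of the total gap exceeds half of the gap from [a] to [p] and each gap is positive. The
    equations have the shape that [phase_arc_split] expects. *)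
Lemma gap_midpoint_split {R : realType} (a p b : R) :
  phases a -> phases p -> phases b -> gap a p + gap p b <= 2 * pi ->
  [/\ gap a (midpoint a p) + gap (midpoint a p) (midpoint a b)
      = gap a (midpoint a b),
      gap (midpoint a b) (midpoint p b) + gap (midpoint p b) b
      = gap (midpoint a b) b
    & gap (midpoint a p) (midpoint a b) + gap (midpoint a b) (midpoint p b)
      = gap (midpoint a p) (midpoint p b)].
Proof.
move=> ha hp hb apb; have gab := gapD_le ha hp hb apb.
have hs := midpoint_phases a p; have ht := midpoint_phases a b.
have hs' := midpoint_phases p b; have gss' := gap_midpointD ha hp hb apb.
have /andP[? _] := gap_itv ha hp; have /andP[? _] := gap_itv hp hb.
have e1 := gap_midpointr ha hp; have e2 := gap_midpointl ha hp.
have e3 := gap_midpointr ha hb; have e4 := gap_midpointl ha hb.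
have e5 := gap_midpointr hp hb; have e6 := gap_midpointl hp hb.
have h1 : gap a (midpoint a p) + gap (midpoint a p) (midpoint a b)
          = gap a (midpoint a b).
  by rewrite gap_split // ifT //; lra.
have h2 : gap (midpoint a b) (midpoint p b) + gap (midpoint p b) b
          = gap (midpoint a b) b.
  have := gap_split ht hs' hb; have /andP[_ ?] := gap_itv ht hs'.
  by case: ifP => // _ ?; lra.
by split=> //; lra.
Qed.

Section Move.
Context {R : realType} {K : nat} {A : finType}.
Variables (d : R -> R -> R) (f rho : R -> R).
Hypotheses (hd : distance_function d) (hf : detection_function d f)
  (hrho : intrusion_density rho).
Implicit Types (c : configuration R K A) (j : 'I_K) (i l m : A).
Local Notation mu := (@lebesgue_measure R).
Local Notation weighted g := (\int[mu]_(x in phases) (g x * rho x)).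

(* Only an inequality: [departure_quantity] hands each half of the sub-area of
   [i] to the adjacent neighbour, whereas the new division point, the midpoint
   between the neighbours, need not be the phase of [i]. *)
Lemma layer_prob_departure c c' i j : valid c -> valid c' ->
  i \in workers c j -> (2 <= #|workers c j|)%N ->
  (forall l, l \in workers c j -> l <> i ->
     l \in workers c' j /\ phase c' l = phase c l) ->
  layer_prob d f rho c j - layer_prob d f rho c' j
  <= departure_quantity d f rho c i.
Proof.
move=> hc hc' hi two sub.
have [m hm nmi] : exists2 m, m \in workers c j & m <> i.
  move: two; rewrite (cardD1 i) hi ltnS => /card_gt0P[m].
  by rewrite inE => /andP[/eqP nmi hm]; exists m.
have [ha _] := pred_agentP hi; have [hb _] := succ_agentP hi.
have nai := pred_agent_neq hc hi hm nmi; have nbi := succ_agent_neq hc hi hm nmi.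
set phi := phase c i; set a := phase c (pred_agent c i).
set b := phase c (succ_agent c i).
have pphi : phases phi := worker_phases hc hi.
have pa : phases a := worker_phases hc ha.
have pb : phases b := worker_phases hc hb.
set s := division c i; set s' := division_next c i.
have ps : phases s := division_phases c i.
have ps' : phases s' := division_phases c _.
have loss_before x : phases x ->
    f (d s phi + d s x) <= coverage d f c' j x.
  move=> px; have [ha' ea] := sub _ ha nai.
  apply: (coverage_ge hd hf hc' ha' px); rewrite ea.
  apply: dist_triangle_midpoint => //.
  by rewrite /s /division delta_midpointl // delta_midpointr.
have loss_after x : phases x ->
    f (d s' phi + d s' x) <= coverage d f c' j x.
  move=> px; have [hb' eb] := sub _ hb nbi.
  apply: (coverage_ge hd hf hc' hb' px); rewrite eb.
  apply: dist_triangle_midpoint => //.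
  rewrite deltaC // [RHS]deltaC // /s' (division_nextE hc hi).
  by rewrite delta_midpointl // delta_midpointr.
have m2 : measurable (subarea2 c i : set (measurableTypeR R)).
  exact: (measurable_phase_arc ps pphi).
have m3 : measurable (subarea3 c i : set (measurableTypeR R)).
  exact: (measurable_phase_arc pphi ps').
pose g2 x := f (d phi x) - f (d s phi + d s x).
pose g3 x := f (d phi x) - f (d s' phi + d s' x).
(* A pointwise bound for the loss of coverage; it is 0 outside the sub-area of [i], where the owner
   stays on the layer. *)
pose D x := \1_(subarea2 c i) x * g2 x + \1_(subarea3 c i) x * g3 x.
have [bc ->] := layer_probE hd hf hrho j hc.
have [bc' ->] := layer_probE hd hf hrho j hc'.
have b2 : bounded_measurable (phases : set (measurableTypeR R))
    (fun x => \1_(subarea2 c i) x * g2 x).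
  apply: bounded_measurableM.
    exact: bounded_measurable_indic.
  apply: bounded_measurableB; first exact: (bounded_measurable_detection hd hf).
  by apply: (bounded_measurable_detectionD hd hf) => //; exact: (dist_ge0 hd).
have b3 : bounded_measurable (phases : set (measurableTypeR R))
    (fun x => \1_(subarea3 c i) x * g3 x).
  apply: bounded_measurableM.
    exact: bounded_measurable_indic.
  apply: bounded_measurableB; first exact: (bounded_measurable_detection hd hf).
  by apply: (bounded_measurable_detectionD hd hf) => //; exact: (dist_ge0 hd).
have -> : departure_quantity d f rho c i = weighted D.
  rewrite (weighted_integralD measurable_phases (integrable_density hrho) b2 b3).
  by congr (_ + _); apply: weighted_integral_indic; exact: phase_arc_sub.
rewrite -(weighted_integralB measurable_phases (integrable_density hrho) bc bc').
have [_ rho0 _] := hrho.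
apply: (le_weighted_integral measurable_phases (integrable_density hrho)) => //.
- exact: bounded_measurableB.
- exact: bounded_measurableD.
move=> x px; rewrite /D.
have [split_iff split_disj] := subarea_split hc hi px.
have [l hl xl] := subarea_cover hc hi px.
have [li|/eqP nli] := eqVneq l i; last first.
  have nxi : ~ subarea c i x.
    by move=> xi; apply: nli; exact: subarea_inj hc hl hi xl xi.
  rewrite !indicE !memNset ?mul0r ?addr0; last 2 first.
  - by move=> h; apply: nxi; apply/split_iff; right.
  - by move=> h; apply: nxi; apply/split_iff; left.
  rewrite subr_le0 (coverage_subarea d f hc hl xl); have [hl' el] := sub _ hl nli.
  by apply: (coverage_ge hd hf hc' hl' px); rewrite el.
rewrite (coverage_subarea d f hc hl xl) li; rewrite li in xl.
case: (split_iff.1 xl) => h.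
  have h' : ~ subarea3 c i x by move=> h'; apply: split_disj.
  rewrite !indicE (mem_set h) (memNset h') mul1r mul0r addr0 lerB //.
  exact: loss_before.
have h' : ~ subarea2 c i x by move=> h'; apply: split_disj.
rewrite !indicE (mem_set h) (memNset h') mul1r mul0r add0r lerB //.
exact: loss_after.
Qed.

(** The subtracted integrals account for the old coverage of the new sub-area, served by [alpha] up
    to the old division point and by [beta] after it. Elsewhere the newcomer can only help. *)
Lemma layer_prob_entry c c' i j : valid c -> valid c' ->
  i \notin workers c j -> workers c' j = i |: workers c j ->
  (forall l, l \in workers c j -> phase c' l = phase c l) ->
  entry_quantity d f rho c c' i j
  <= layer_prob d f rho c' j - layer_prob d f rho c j.
Proof.
move=> hc hc' nhi W' same.
have hi : i \in workers c' j by rewrite W' setU11.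
have sub l : l \in workers c j -> l \in workers c' j /\ phase c' l = phase c l.
  by move=> hl; split; [rewrite W' setU1r|exact: same].
have [ha amin] := pred_agentP hi; have [hb bmin] := succ_agentP hi.
set p := phase c' i; set al := pred_agent c' i; set be := succ_agent c' i.
set a := phase c' al; set b := phase c' be.
have pp : phases p := worker_phases hc' hi.
have pa : phases a := worker_phases hc' ha.
have pb : phases b := worker_phases hc' hb.
set s := division c' i; set s' := division_next c' i; set t := division c be.
have ps : phases s := division_phases c' i.
have ps' : phases s' := division_phases c' _.
have pt : phases t := division_phases c _.
have [bc ->] := layer_probE hd hf hrho j hc.
have [bc' ->] := layer_probE hd hf hrho j hc'.
pose gi x := \1_(subarea2 c' i `|` subarea3 c' i) x * f (d p x).
pose gb x := \1_(phase_arc t s') x * f (d b x).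
pose ga x := \1_(phase_arc s t) x * f (d a x).
have bgi : bounded_measurable (phases : set (measurableTypeR R)) gi.
  apply: bounded_measurableM; last exact: (bounded_measurable_detection hd hf).
  apply: bounded_measurable_indic; apply: measurableU.
    exact: (measurable_phase_arc ps pp).
  exact: (measurable_phase_arc pp ps').
have bgb : bounded_measurable (phases : set (measurableTypeR R)) gb.
  exact: (bounded_measurable_arc_detection hd hf).
have bga : bounded_measurable (phases : set (measurableTypeR R)) ga.
  exact: (bounded_measurable_arc_detection hd hf).
have Ei : \int[mu]_(x in subarea2 c' i `|` subarea3 c' i) (f (d p x) * rho x)
          = weighted gi.
  apply: weighted_integral_indic.
  by rewrite subUset; split; exact: phase_arc_sub.
rewrite /entry_quantity -/p Ei.
have [_ rho0 _] := hrho.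
have iE x : phases x -> \1_(subarea2 c' i `|` subarea3 c' i) x
    = \1_(subarea c' i) x :> R.
  move=> px; have [split_iff _] := subarea_split hc' hi px.
  rewrite !indicE; congr (_%:R); congr nat_of_bool.
  by apply/idP/idP => /set_mem h; apply: mem_set; apply/split_iff.
rewrite -(weighted_integralB measurable_phases (integrable_density hrho) bc' bc).
have [W0|[m hm]] := set_0Vmem (workers c j).
  (* On an empty layer the old coverage is 0 and [i] alone contributes, so the two integrands
     agree. *)
  rewrite W0 eqxx subr0.
  apply: (le_weighted_integral measurable_phases (integrable_density hrho)) => //.
    exact: bounded_measurableB.
  move=> x px; rewrite /gi iE // /coverage W' W0 finset.setU0 big_set1 big_set0.
  by rewrite subr0.
have nmi : m <> i by move=> mi; move: nhi; rewrite -mi hm.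
have hm' := (sub _ hm).1.
have in_c l : l \in workers c' j -> l <> i -> l \in workers c j.
  by rewrite W' => /setU1P[].
have hal := in_c _ ha (pred_agent_neq hc' hi hm' nmi).
have hbe := in_c _ hb (succ_agent_neq hc' hi hm' nmi).
have apb : gap a p + gap p b <= 2 * pi := gap_neighbours hc' hi hm' nmi.
have ea : phase c al = a by rewrite -same.
have eb : phase c be = b by rewrite -same.
have adj l : l \in workers c j -> gap a b <= gap (phase c l) b.
  move=> hl; have [hl' el] := sub _ hl; rewrite -el.
  have nli : l <> i by move=> li; move: nhi; rewrite -li hl.
  apply: (gap_adjacent_le pa pp pb (worker_phases hc' hl') _ apb).
  - exact: worker_phase_inj hc' hl' hi nli.
  - exact: amin.
  - exact: bmin.
have tE : t = midpoint a b.
  by rewrite /t (division_adjacent hc hal hbe) ?ea ?eb.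
have s'E : s' = midpoint p b by rewrite /s' (division_nextE hc' hi).
have [g1 g2 g3] := gap_midpoint_split pa pp pb apb.
rewrite -tE -s'E -[midpoint a p]/s in g1 g2 g3.
(* It is enough that [beta] is nearest on its arc, and [alpha] on the other: the old owner [w] is
   then no nearer, and ownership at ties need not be settled. *)
have near_b l x : l \in workers c j -> phases x -> phase_arc t s' x ->
    delta b x <= delta (phase c l) x.
  move=> hl px xt; have pl := worker_phases hc hl.
  have [h _] := phase_arc_split pt ps' pb px g2.
  have := h.2 (or_introl xt); rewrite tE => xtb.
  by have [] := half_arc_before pa pb pl px (adj _ hl) xtb.
have near_a l x : l \in workers c j -> phases x -> phase_arc s t x ->
    delta a x <= delta (phase c l) x.
  move=> hl px xt; have pl := worker_phases hc hl.
  have [h _] := phase_arc_split pa ps pt px g1.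
  have := h.2 (or_intror xt); rewrite tE => xat.
  have [->//|/eqP nla] := eqVneq (phase c l) a.
  by rewrite ltW // (half_arc_after pa pb pl px (adj _ hl)).
rewrite ifF; last by apply/negbTE/set0Pn; exists m.
have -> : \int[mu]_(x in phase_arc t s') (f (d b x) * rho x) = weighted gb.
  by apply: weighted_integral_indic; exact: phase_arc_sub.
have -> : \int[mu]_(x in phase_arc s t) (f (d a x) * rho x) = weighted ga.
  by apply: weighted_integral_indic; exact: phase_arc_sub.
have bgab := bounded_measurableD bgb bga.
rewrite -(weighted_integralD measurable_phases (integrable_density hrho) bgb bga).
rewrite -(weighted_integralB measurable_phases (integrable_density hrho) bgi bgab).
apply: (le_weighted_integral measurable_phases (integrable_density hrho)) => //.
- exact: bounded_measurableB.
- exact: bounded_measurableB.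
move=> x px; rewrite /gi /gb /ga iE //.
have [arc_iff arc_disj] := phase_arc_split ps pt ps' px g3.
have [l hl xl] := subarea_cover hc' hi px.
have [li|/eqP nli] := eqVneq l i; last first.
  have nxi : ~ subarea c' i x.
    by move=> xi; apply: nli; exact: subarea_inj hc' hl hi xl xi.
  rewrite !indicE !memNset //; last 2 first.
  - by move=> h; apply: nxi; apply/arc_iff; left.
  - by move=> h; apply: nxi; apply/arc_iff; right.
  by rewrite !mul0r addr0 subr0 subr_ge0 (coverage_mono hd hf hc hc' px).
rewrite (coverage_subarea d f hc' hl xl) li; rewrite li in xl.
have [w hw xw] := subarea_cover hc hm px.
rewrite (coverage_subarea d f hc hw xw) indicE (mem_set xl) mul1r lerB //.
have pw := worker_phases hc hw.
case: (arc_iff.1 xl) => h.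
  have h' : ~ phase_arc t s' x by move=> h'; apply: arc_disj.
  rewrite !indicE (mem_set h) (memNset h') mul1r mul0r add0r.
  apply: (detection_anti hf); first exact: (dist_ge0 hd).
  by apply: (le_dist hd) => //; exact: near_a.
have h' : ~ phase_arc s t x by move=> h'; apply: arc_disj.
rewrite !indicE (mem_set h) (memNset h') mul1r mul0r addr0.
apply: (detection_anti hf); first exact: (dist_ge0 hd).
by apply: (le_dist hd) => //; exact: near_b.
Qed.

(** Monotonicity of coverage in both directions avoids relating neighbours that are chosen by
    [arg min] in two different configurations. *)
Lemma layer_prob_congr c c' j : valid c -> valid c' ->
  workers c' j = workers c j ->
  (forall l, l \in workers c j -> phase c' l = phase c l) ->
  layer_prob d f rho c' j = layer_prob d f rho c j.
Proof.
move=> hc hc' W' same.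
have [_ ->] := layer_probE hd hf hrho j hc.
have [_ ->] := layer_probE hd hf hrho j hc'.
apply: eq_Rintegral => x /set_mem px; congr (_ * _); apply/le_anti/andP.
split; apply: (coverage_mono hd hf) => // l.
  by rewrite W' => hl; rewrite same.
by move=> hl; rewrite W' same.
Qed.

End Move.

(** * Combining the bounds for the two affected layers *)

Theorem theorem3p2 (R : realType) (K : nat) (A : finType)
  (r : 'I_K -> R -> R) (d : R -> R -> R) (f rho : R -> R)
  (c : configuration R K A) (i : A) (k v : 'I_K) (psi : R)
  (hr : layer_curves r)
  (hd : distance_function d)
  (hf : detection_function d f)
  (hrho : intrusion_density rho)
  (hc : valid c)
  (hik : i \in workers c k)
  (hNk : (2 <= #|workers c k|)%N)
  (hvk : v != k)
  (hc' : valid (move c i v psi))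
  (hP : departure_quantity d f rho c i
        < (1 - layer_prob d f rho c k)
            * entry_quantity d f rho c (move c i v psi) i v
          / (1 - layer_prob d f rho c v
               - entry_quantity d f rho c (move c i v psi) i v)) :
  system_prob d f rho c < system_prob d f rho (move c i v psi).
Proof.
set c' := move c i v psi in hc' hP *.
have ci : layer c i = Some k by move: hik; rewrite inE => /eqP.
have Wv : workers c' v = i |: workers c v.
  by apply/setP => l; rewrite !inE /=; case: (eqVneq l i) => //=; rewrite eqxx.
have Wj j : j != v -> workers c' j = workers c j :\ i.
  move=> jv; apply/setP => l; rewrite !inE /=; case: (eqVneq l i) => //= _.
  by apply/eqP => -[vj]; move: jv; rewrite vj eqxx.
have nWi j : j != k -> i \notin workers c j.
  by move=> jk; rewrite inE ci; apply/eqP => -[kj]; move: jk; rewrite kj eqxx.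
have same l : l <> i -> phase c' l = phase c l by rewrite /=; case: eqP.
have dep : layer_prob d f rho c k - layer_prob d f rho c' k
    <= departure_quantity d f rho c i.
  apply: layer_prob_departure => // l hl nli; split; last exact: same.
  by rewrite Wj 1?eq_sym // finset.in_setD1 hl andbT; apply/eqP.
have ent : entry_quantity d f rho c c' i v
    <= layer_prob d f rho c' v - layer_prob d f rho c v.
  apply: layer_prob_entry => //; first exact: nWi.
  by move=> l hl; apply: same => li; have := nWi _ hvk; rewrite -li hl.
have oth j : j != v -> j != k -> layer_prob d f rho c' j = layer_prob d f rho c j.
  move=> jv jk; apply: layer_prob_congr => //.
    rewrite Wj //; apply/setP => l; rewrite !inE; case: (eqVneq l i) => //= ->.
    by have := nWi _ jk; rewrite inE => /negbTE.
  by move=> l hl; apply: same => li; have := nWi _ jk; rewrite -li hl.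
have lt1 := layer_prob_lt1 hd hf hrho.
have hk := lt1 _ _ _ k hc; have hv' := lt1 _ _ _ v hc'.
have hk' := lt1 _ _ _ k hc'.
rewrite /system_prob ltrD2l ltrN2.
rewrite (bigD1 v) //= (bigD1 k) 1?eq_sym //= mulrA.
rewrite [ltRHS](bigD1 v) //= [in ltRHS](bigD1 k) 1?eq_sym //= [ltRHS]mulrA.
rewrite (eq_bigr (fun j => 1 - layer_prob d f rho c j)); last first.
  by move=> j /andP[jv jk]; rewrite oth.
rewrite ltr_pM2r; last by apply: prodr_gt0 => j _; rewrite subr_gt0 lt1.
move: hP dep ent hk hv' hk'.
move: (departure_quantity _ _ _ _ _) (entry_quantity _ _ _ _ _ _ _) => D E.
move: (layer_prob d f rho c k) (layer_prob d f rho c' k) => Pk Pk'.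
move: (layer_prob d f rho c v) (layer_prob d f rho c' v) => Pv Pv'.
move=> hP dep ent hk hv' hk'.
(* By [ent] this quantity is at least [1 - Pv'], so it is the layer probability after the move that
   has to be below 1. *)
have den0 : 0 < 1 - Pv - E by lra.
rewrite ltr_pdivlMr // in hP.
(* The factors are bounded one by one through [ent] and [dep]; the strict step is [hP] with its
   denominator cleared. *)
apply: (@le_lt_trans _ _ ((1 - Pv - E) * (1 - Pk + D))).
  by rewrite ler_pM //; lra.
by rewrite mulrC in hP; rewrite mulrDr [X in X + _]mulrC; lra.
Qed.
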